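(* Let $X,Y$ be finite nonempty sets and $W=(X\times Y)^{\mathbb{N}}$. Let $S=\bigcup_{i\in\mathbb{N}} D_i$ be a $G_{\delta\sigma}$ subset of $W$ (each $D_i\subseteq W$ a $G_\delta$ set). Then the Blackwell game $\Gamma(S)$ is determined, i.e. $\mathrm{val}^\downarrow(\Gamma(S))=\mathrm{val}^\uparrow(\Gamma(S))$.
   Context: $X,Y$ are finite nonempty sets, $Z=X\times Y$, $W=Z^{\mathbb{N}}$ (infinite plays), $P=Z^{<\omega}$ (positions). $W$ carries the product topology of the discrete topology on $Z$. For $p\in P$, $[p]\subseteq W$ is the set of plays having $p$ as an initial segment; $p_{\mid i}$ is the initial segment of $p$ of length $i$. Blackwell game $\Gamma(f)$, for $f:W\to\mathbb{R}$ bounded Borel: in each round player I picks $x\in X$ and simultaneously player II picks $y\in Y$, then both are told $(x,y)$; after infinitely many rounds a play $w\in W$ results and II pays I the amount $f(w)$. A strategy for I is a function $\sigma$ assigning to each $p\in P$ a probability distribution $\sigma(p)$ on $X$; a strategy for II is a function $\tau$ assigning to each $p\in P$ a probability distribution $\tau(p)$ on $Y$. They determine the Borel probability measure $\mu_{\sigma,\tau}$ on $W$ with $\mu_{\sigma,\tau}[p]=\prod_{i=1}^n \sigma(p_{\mid(i-1)})(x_i)\,\tau(p_{\mid(i-1)})(y_i)$ for $p=(x_1,y_1,\dots,x_n,y_n)$. Put $E(\sigma,\tau,f)=\int f\,d\mu_{\sigma,\tau}$. The lower and upper values are $\mathrm{val}^\downarrow(\Gamma(f))=\sup_\sigma\inf_\tau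 E(\sigma,\tau,f)$ and $\mathrm{val}^\uparrow(\Gamma(f))=\inf_\tau\sup_\sigma E(\sigma,\tau,f)$. For $S\subseteq W$, $\Gamma(S)$ means $\Gamma(I_S)$, with $I_S$ the indicator function of $S$. *)

(* Defs.v *)
From HB Require Import structures.
From mathcomp Require Import all_boot all_order all_algebra.
From mathcomp Require Import all_classical all_reals all_analysis.

Set Implicit Arguments.
Unset Strict Implicit.
Unset Printing Implicit Defensive.

Import Order.TTheory GRing.Theory Num.Theory.
Import numFieldNormedType.Exports.

Local Open Scope classical_set_scope.
Local Open Scope ring_scope.

(* Finite nonempty sets.  The distinguished point only witnesses nonemptiness
   (the library asks measurable types to be pointed). *)
#[short(type="pointedFinType")]
HB.structure Definition PointedFinite := {T of Pointed T & Finite T}.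

Record fdist (R : realType) (T : finType) := FDist {
  fdist_fun :> T -> R ;
  fdist_ge0 : forall x, 0 <= fdist_fun x ;
  fdist_sum1 : \sum_x fdist_fun x = 1 }.

Definition position (X Y : finType) : Type := seq (X * Y).

Definition play (X Y : finType) : Type :=
  prod_topology (fun _ : nat => discrete_topology (X * Y)%type).

HB.instance Definition _ (X Y : finType) := Topological.on (play X Y).
HB.instance Definition _ (X Y : pointedFinType) := Pointed.on (play X Y).

HB.instance Definition _ (X Y : pointedFinType) := Measurable.copy (play X Y)
  (g_sigma_algebraType (@open (play X Y))).

Definition play_prefix (X Y : finType) (w : play X Y) (n : nat) :
  position X Y := mkseq w n.

Definition cylinder (X Y : finType) (p : position X Y) : set (play X Y) :=
  [set w | play_prefix w (size p) = p].

Definition strategyI (R : realType) (X Y : finType) : Type :=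
  position X Y -> fdist R X.

Definition strategyII (R : realType) (X Y : finType) : Type :=
  position X Y -> fdist R Y.

Definition position_weight (R : realType) (X Y : pointedFinType)
    (s : strategyI R X Y) (t : strategyII R X Y) (p : position X Y) : R :=
  \prod_(i < size p)
    (s (take i p) (nth point p i).1 * t (take i p) (nth point p i).2).

Section play_measure_construction.
Context {R : realType} {X Y : pointedFinType}.
Variables (s : strategyI R X Y) (t : strategyII R X Y).
Local Notation Z := (X * Y)%type.
Local Notation W := (play X Y).
Implicit Types (p q : position X Y) (A B : set W) (n : nat).

Let step p (z : Z) : R := s p z.1 * t p z.2.

Let step_ge0 p z : 0 <= step p z.
Proof. by rewrite mulr_ge0 ?fdist_ge0. Qed.

Let step_sum1 p : \sum_z step p z = 1.
Proof.
rewrite -(pair_bigA _ (fun x y => s p x * t p y)) /=.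
under eq_bigr do rewrite -big_distrr /= fdist_sum1 mulr1.
by rewrite fdist_sum1.
Qed.

Let extend p : W := fun i => nth point p i.

(* A depends only on the first n rounds. *)
Let level n A := forall w w' : W,
  play_prefix w n = play_prefix w' n -> A w -> A w'.

Let prefixP (w w' : W) n :
  (forall i, (i < n)%N -> w i = w' i) <-> play_prefix w n = play_prefix w' n.
Proof.
split=> [h|h i ltin].
  by apply/eq_in_map => i; rewrite mem_iota => /andP[_]; exact: h.
by have := congr1 (fun u : seq Z => nth point u i) h; rewrite !nth_mkseq.
Qed.

Let level_leq n m A : (n <= m)%N -> level n A -> level m A.
Proof.
move=> nm lA w w' /prefixP e; apply: lA; apply/prefixP => i lin.
by apply: e; exact: leq_trans nm.
Qed.

Let levelC n A : level n A -> level n (~` A).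
Proof. by move=> lA w w' e nA Aw'; apply: nA; apply: lA Aw'. Qed.

Let levelU n A B : level n A -> level n B -> level n (A `|` B).
Proof. by move=> lA lB w w' e [/(lA _ _ e)|/(lB _ _ e)]; [left|right]. Qed.

Let level_cylinder p : level (size p) (cylinder p).
Proof. by move=> w w' e; rewrite /cylinder /= -e. Qed.

(* Probability of A when play starts from p, if A is decided within n more
   rounds. *)
Fixpoint level_prob n p A : R :=
  if n is m.+1 then \sum_z step p z * level_prob m (rcons p z) A
  else `[< A (extend p) >]%:R.

Let level_prob_ge0 n p A : 0 <= level_prob n p A.
Proof.
elim: n p => [|n ih] p /=; first by rewrite ler0n.
by rewrite sumr_ge0// => z _; rewrite mulr_ge0.
Qed.

Let level_probU n p A B : A `&` B = set0 ->
  level_prob n p (A `|` B) = level_prob n p A + level_prob n p B.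
Proof.
move=> AB; elim: n p => [|n ih] p /=.
  rewrite asbool_or -natrD; congr (_%:R).
  case: asboolP => a; case: asboolP => b //.
  by have : (A `&` B) (extend p) by []; rewrite AB.
by rewrite -big_split; apply: eq_bigr => z _; rewrite ih mulrDr.
Qed.

Let level_probT n p : level_prob n p setT = 1.
Proof.
elim: n p => [|n ih] p /=; first by rewrite asboolT.
by under eq_bigr do rewrite ih mulr1; exact: step_sum1.
Qed.

Let level_prob_set0 n p A : (forall r, ~ A (extend (p ++ r))) ->
  level_prob n p A = 0.
Proof.
elim: n p => [|n ih] p /= h.
  by rewrite asboolF//; have := h [::]; rewrite cats0.
rewrite big1// => z _; rewrite ih ?mulr0// => r.
by rewrite cat_rcons; exact: h.
Qed.

Let extend_prefix p : play_prefix (extend p) (size p) = p.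
Proof. exact: mkseq_nth. Qed.

Let level_probS n p A : level (size p + n) A ->
  level_prob n.+1 p A = level_prob n p A.
Proof.
elim: n p => [|n ih] p lA; last first.
  apply: eq_bigr => z _; congr (_ * _); apply: ih.
  by rewrite size_rcons addSnnS.
rewrite addn0 in lA => /=.
suff h z : `[< A (extend (rcons p z)) >] = `[< A (extend p) >].
  by under eq_bigr do rewrite h; rewrite -big_distrl /= step_sum1 mul1r.
have e : play_prefix (extend (rcons p z)) (size p)
       = play_prefix (extend p) (size p).
  by apply/prefixP => i ip; rewrite /extend nth_rcons ip.
by apply/asbool_equiv_eq; split; apply: lA.
Qed.

Let level_prob_leq n m A : (n <= m)%N -> level n A ->
  level_prob m [::] A = level_prob n [::] A.
Proof.
move=> nm lA; rewrite -(subnK nm); elim: (m - n)%N => // k <-.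
by rewrite addSn level_probS//; apply: level_leq lA; rewrite add0n leq_addl.
Qed.

Let level_prob_cylinder p : level_prob (size p) [::] (cylinder p)
  = position_weight s t p.
Proof.
rewrite /position_weight.
suff h k q r : p = q ++ r -> k = size r ->
    level_prob k q (cylinder p) = \prod_(i < k) step (take (size q + i) p)
                                   (nth point p (size q + i)).
  by rewrite (h _ [::] p).
elim: k q r => [|k ih] q r pE kr.
  rewrite big_ord0 /= asboolT// /cylinder /=.
  by move: pE; rewrite (size0nil (esym kr)) cats0 => ->; exact: extend_prefix.
case: r pE kr => // z r pE [kr] /=.
rewrite (bigD1 z)//= (ih _ r) ?cat_rcons// [X in _ + X]big1 ?addr0 => [|z' z'z].
  rewrite big_ord_recl addn0.
  have -> : take (size q) p = q by rewrite pE take_size_cat.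
  have -> : nth point p (size q) = z by rewrite pE nth_cat ltnn subnn.
  congr (_ * _); apply: eq_bigr => i _.
  by rewrite size_rcons addSnnS.
rewrite level_prob_set0 ?mulr0// => u; rewrite /cylinder /= => h.
have := congr1 (fun v : seq Z => nth point v (size q)) h.
rewrite pE nth_mkseq ?size_cat/= ?addnS ?ltnS ?leq_addr//.
rewrite /extend cat_rcons !nth_cat ltnn subnn /= => zz.
by rewrite zz eqxx in z'z.
Qed.

(* The algebra of sets decided after finitely many rounds.  A set in it is
   compact and open, so the content defined on it is sigma-additive and extends
   to the Borel sets. *)
Definition finitary_play : Type := W.
HB.instance Definition _ := Pointed.on finitary_play.

Let finitary : set (set finitary_play) := [set A | exists n, level n A].

Let finitary0 : finitary set0. Proof. by exists 0%N. Qed.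

Let finitaryC : setC_closed finitary.
Proof. by move=> A [n lA]; exists n; exact: levelC. Qed.

Let finitaryU : setU_closed finitary.
Proof.
move=> A B [n lA] [m lB]; exists (maxn n m); apply: levelU.
  by apply: level_leq lA; rewrite leq_maxl.
by apply: level_leq lB; rewrite leq_maxr.
Qed.

HB.instance Definition _ := @isAlgebraOfSets.Build default_measure_display
  finitary_play finitary finitary0 finitaryU finitaryC.

Let finitary_prob (A : set finitary_play) : \bar R :=
  (level_prob (get [set n | level n A]) [::] A)%:E.

Let finitary_probE n A : level n A ->
  finitary_prob A = (level_prob n [::] A)%:E.
Proof.
move=> lA; have lg : level (get [set n | level n A]) A.
  by apply: (@getPex _ [set n | level n A]); exists n.
rewrite /finitary_prob; congr EFin.
case/orP: (leq_total n (get [set n | level n A])) => h.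
  exact: level_prob_leq.
by apply/esym; exact: level_prob_leq.
Qed.

Let cylinder_prefix (v w : W) n : cylinder (play_prefix w n) v <->
  (forall i, (i < n)%N -> v i = w i).
Proof. by rewrite prefixP /cylinder /= {1}/play_prefix size_mkseq. Qed.

Let nbhs_cylinder (w : W) (U : set W) : nbhs w U ->
  exists n, cylinder (play_prefix w n) `<=` U.
Proof.
pose F := filter_from [set: nat] (fun n => cylinder (play_prefix w n)).
have FF : Filter F.
  apply: filter_from_filter; first by exists 0%N.
  move=> i j _ _; exists (maxn i j) => // v.
  move=> /cylinder_prefix h; split; apply/cylinder_prefix => k ?;
    by apply: h; rewrite leq_max; apply/orP; [left + right].
suff Fw : F --> w by move=> /Fw[n _ nU]; exists n.
apply/(@cvg_sup _ _ (fun i => Topological.class (initial_topology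
  (fun f : W => f i)))) => i.
apply/cvg_image; first by apply/seteqP; split => // z _; exists (fun=> z).
move=> V /nbhs_singleton Vwi; exists [set v : W | V (v i)].
  by exists i.+1 => // v /cylinder_prefix h /=; rewrite h.
by apply/seteqP; split => [_ [v Vv <-]//|z Vz]; exists (fun=> z).
Qed.

Let cylinder_nbhs (w : W) n : nbhs w (cylinder (play_prefix w n)).
Proof.
elim: n => [|n ih].
  by apply: filterS filterT => v _; apply/cylinder_prefix.
have : nbhs w [set v : W | v n = w n].
  exact: (@proj_continuous _ (fun=> discrete_topology Z) n w _
    (discrete_set1 _)).
apply: filterS2 ih => v /cylinder_prefix h vn.
apply/cylinder_prefix => i; rewrite ltnS leq_eqVlt => /predU1P[->//|]; exact: h.
Qed.

Let level_open n A : level n A -> open A.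
Proof.
move=> lA; rewrite openE => w Aw; apply: filterS (cylinder_nbhs w n) => v.
by move=> /cylinder_prefix/prefixP/esym e; apply: lA Aw.
Qed.

Let play_compact : compact [set: W].
Proof.
have fZ : finite_set [set: discrete_topology Z].
  exact: (@finite_finset Z).
have := tychonoff (fun _ : nat => finite_compact fZ).
by congr (compact _); rewrite eqEsubset; split.
Qed.

Let finitary_compact (A : set W) : finitary A -> compact A.
Proof.
move=> [n lA]; apply: subclosed_compact play_compact _ => //.
by rewrite -[A]setCK; apply: open_closedC; apply: level_open (levelC lA).
Qed.

Let finitary_prob0 : finitary_prob set0 = 0%E.
Proof. by rewrite (@finitary_probE 0%N)//= asboolF. Qed.

Let finitary_prob_ge0 A : (0 <= finitary_prob A)%E.
Proof. by rewrite lee_fin level_prob_ge0. Qed.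

Let finitary_prob_additive2 : semi_additive2 finitary_prob.
Proof.
move=> A B [n lA] [m lB] _ AB; pose k := maxn n m.
have {}lA : level k A by apply: level_leq lA; rewrite leq_maxl.
have {}lB : level k B by apply: level_leq lB; rewrite leq_maxr.
rewrite (finitary_probE (levelU lA lB)) (finitary_probE lA) (finitary_probE lB).
by rewrite level_probU.
Qed.

Let finitary_prob_sigma_additive : semi_sigma_additive finitary_prob.
Proof.
move=> F mF tF mUF.
have /finitary_compact := mUF; rewrite compact_cover.
have oF i : setT i -> open (F i : set W).
  by move=> _; have [n] := mF i; exact: level_open.
move=> /(_ _ setT _ oF)[//|D _ UD].
pose N := (\max_(i <- finmap.enum_fset D) i).+1.
have FN n : (N <= n)%N -> \bigcup_i F i = \big[setU/set0]_(i < n) F i.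
  move=> Nn; rewrite -bigcup_mkord eqEsubset; split; last first.
    by move=> w [i _ ?]; exists i.
  move=> w /UD[i /= iD Fiw]; exists i => //=; apply: leq_trans Nn.
  by rewrite ltnS; apply: (@leq_bigmax_seq _ _ xpredT id).
apply: cvg_near_cst; exists N => // n /= Nn.
rewrite big_mkord (FN _ Nn); apply/esym.
apply: ((additive2P finitary_prob0).2 _ F n) => //.
  by rewrite -semi_additive2E.
by rewrite -(FN _ Nn).
Qed.

HB.instance Definition _ := isMeasure.Build _ finitary_play R finitary_prob
  finitary_prob0 finitary_prob_ge0 finitary_prob_sigma_additive.

Let generated : Type := g_sigma_algebraType (@measurable _ finitary_play).

Let cylinder_finitary p : finitary (cylinder p).
Proof. by exists (size p); exact: level_cylinder. Qed.

Let open_bigcup (U : set W) : open U ->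
  U = \bigcup_(p in [set p | cylinder p `<=` U]) cylinder p.
Proof.
rewrite openE => oU; rewrite eqEsubset; split=> [w Uw|]; last exact: bigcup_sub.
have [n nU] := nbhs_cylinder (oU _ Uw).
by exists (play_prefix w n) => //; apply/cylinder_prefix.
Qed.

(* Cylinders (with the empty set) form a pi-system generating the Borel sets. *)
Let cylinders : set (set W) := [set A | A = set0 \/ exists p, A = cylinder p].

Let measurable_cylinders : @measurable _ W = <<s cylinders >>.
Proof.
rewrite eqEsubset; split; last first.
  apply: smallest_sub; first exact: smallest_sigma_algebra.
  move=> _ [->|[p ->]]; first exact: measurable0.
  by apply: sub_sigma_algebra; apply: level_open (@level_cylinder p).
apply: smallest_sub; first exact: smallest_sigma_algebra.
move=> U /open_bigcup ->.
rewrite bigcup_mkcond.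
apply: (@countable_bigcupT_measurable _ (g_sigma_algebraType cylinders))
  => [|p].
  exact: (@countableP (seq Z)).

case: ifPn => _; last exact: measurable0.
by apply: sub_sigma_algebra; right; exists p.
Qed.

Let setI_cylinders : setI_closed cylinders.
Proof.
move=> _ _ [->|[p ->]] [->|[q ->]]; rewrite ?setI0 ?set0I; [by left..|].
wlog pq : p q / (size p <= size q)%N.
  by move=> h; case/orP: (leq_total (size p) (size q)) => /h//; rewrite setIC.
have [->|/set0P[w [wp wq]]] := eqVneq (cylinder p `&` cylinder q) set0.
  by left.
right; exists q; rewrite setIidr// => v vq.
have /prefixP h : play_prefix v (size q) = play_prefix w (size q).
  by rewrite [LHS]vq [RHS]wq.
rewrite /cylinder /=; transitivity (play_prefix w (size p)); last exact: wp.
by apply/prefixP => i ip; apply: h; exact: leq_trans pq.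
Qed.

Let generated_measurable (A : set W) : measurable A ->
  @measurable _ generated A.
Proof.
rewrite measurable_cylinders; apply: smallest_sub.
  exact: smallest_sigma_algebra.
move=> _ [->|[p ->]]; first exact: (@measurable0 _ generated).
exact: sub_sigma_algebra (cylinder_finitary p).
Qed.

Let play_prob (A : set W) : \bar R := measure_extension finitary_prob A.

Let play_prob0 : play_prob set0 = 0%E.
Proof. exact: measure0. Qed.

Let play_prob_ge0 A : (0 <= play_prob A)%E.
Proof. exact: measure_ge0. Qed.

Let play_prob_sigma_additive : @semi_sigma_additive _ _ W play_prob.
Proof.
move=> F mF tF mUF.
apply: (@measure_semi_sigma_additive _ generated R
  (measure_extension finitary_prob)) => //.
  by move=> i; exact: generated_measurable.
exact: generated_measurable.
Qed.

Let play_probE (A : set W) : finitary A -> play_prob A = finitary_prob A.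
Proof.
by move=> fA; rewrite /play_prob /measure_extension measurable_mu_extE.
Qed.

Let play_probT : play_prob setT = 1%E.
Proof.
have lT : level 0 setT by [].
rewrite play_probE; first by rewrite (finitary_probE lT) level_probT.
by exists 0%N.
Qed.

Lemma play_measure_exists : exists mu : probability W R,
  forall p, mu (cylinder p) = (position_weight s t p)%:E.
Proof.
pose M : {measure set W -> \bar R} := HB.pack play_prob
  (isMeasure.Build _ W R play_prob play_prob0 play_prob_ge0
    play_prob_sigma_additive).
pose P : probability W R := HB.pack play_prob M
  (Measure_isProbability.Build _ W R M play_probT).
exists P => p; rewrite /= play_probE//.
by rewrite (finitary_probE (@level_cylinder p)) level_prob_cylinder.
Qed.

Lemma play_measure_unique (mu nu : probability W R) :
  (forall p, mu (cylinder p) = (position_weight s t p)%:E) ->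
  (forall p, nu (cylinder p) = (position_weight s t p)%:E) ->
  forall A, measurable A -> mu A = nu A.
Proof.
move=> muE nuE A mA.
have cylT : cylinder [::] = [set: W] by rewrite eqEsubset; split.
apply: (measure_unique cylinders (fun=> setT) measurable_cylinders
  setI_cylinders) => //.
- by move=> i; right; exists [::]; exact: (esym cylT).
- by rewrite bigcup_const.
- move=> _ [->|[p ->]]; first by rewrite !measure0.
  exact: etrans (muE p) (esym (nuE p)).
- move=> i; apply: (@le_lt_trans _ _ 1%E); last exact: ltry.
  exact: probability_le1.
Qed.

End play_measure_construction.

Definition play_measure (R : realType) (X Y : pointedFinType)
    (s : strategyI R X Y) (t : strategyII R X Y) : probability (play X Y) R :=
  projT1 (cid (play_measure_exists s t)).

Lemma play_measureE (R : realType) (X Y : pointedFinType)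
    (s : strategyI R X Y) (t : strategyII R X Y) (p : position X Y) :
  play_measure s t (cylinder p) = (position_weight s t p)%:E.
Proof. by rewrite /play_measure; case: cid => mu /= ->. Qed.

Definition expected_payoff (R : realType) (X Y : pointedFinType)
    (s : strategyI R X Y) (t : strategyII R X Y) (f : play X Y -> R) : \bar R :=
  (\int[play_measure s t]_w (f w)%:E)%E.

(* The values live in the extended reals so that the suprema and infima are
   total; for bounded Borel f they are finite. *)
Definition lower_value (R : realType) (X Y : pointedFinType)
    (f : play X Y -> R) : \bar R :=
  ereal_sup [set ereal_inf [set expected_payoff s t f |
    t in [set: strategyII R X Y]] | s in [set: strategyI R X Y]].

Definition upper_value (R : realType) (X Y : pointedFinType)
    (f : play X Y -> R) : \bar R :=
  ereal_inf [set ereal_sup [set expected_payoff s t f |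
    s in [set: strategyI R X Y]] | t in [set: strategyII R X Y]].

Definition determined (R : realType) (X Y : pointedFinType)
    (f : play X Y -> R) : Prop := lower_value f = upper_value f.

(* Main.v *)
(* The Blackwell game is reduced to a game of perfect information, following
   Martin.  Fix v.  A position of the auxiliary game carries a score, initially
   v; player I moves by choosing h : X * Y -> [0, 1] such that the matrix game h
   has value at least the score, player II answers with z, and h z is the new
   score.  I wins if the resulting play is in S or the score ever reaches 0.
   - If I wins, she plays optimally in each matrix game h: the score is then a
     submartingale bounded by 1, so with probability at least v it never reaches
     0, and then the play lies in S.
   - If II wins by a strategy m, let u z be the infimum of the scores h z over
     the moves h that m answers by z (and 1 if there is none).  The matrix game u
     has value at most the current score, so playing it nearly optimally makes
     the score a supermartingale up to small errors, and plays in S force it to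
     become 1 at some point: this happens with probability at most v + e.
   In both cases Ville's inequality gives the estimate.

   The auxiliary game is a G_delta_sigma game, so it is determined by Davis'
   theorem.  Restrictions of player II to subtrees are replaced here by
   enlarging the winning set of I by an open set V: if I does not win P from p,
   and B is a G_delta subset of P, then for some open V covering B above p, I
   does not win the union of P and V either.  Player II applies this to the n-th
   G_delta set at round n. *)

Require Import Defs.
From mathcomp Require Import all_boot all_order all_algebra.
From mathcomp Require Import all_classical all_reals all_analysis.
From mathcomp Require Import borel_hierarchy ring lra.

Set Implicit Arguments.
Unset Strict Implicit.
Unset Printing Implicit Defensive.

Import Order.TTheory GRing.Theory Num.Theory.
Import numFieldNormedType.Exports.

Local Open Scope classical_set_scope.
Local Open Scope ring_scope.

(** * Determinacy of G_delta_sigma games of perfect information *)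

Lemma mkseq_eqP (T : Type) (x y : nat -> T) n :
  mkseq x n = mkseq y n <-> forall i, (i < n)%N -> x i = y i.
Proof.
elim: n => [|n ih]; first by split.
rewrite !mkseqS; split=> [/rcons_inj[/ih h xy] i|h].
  by rewrite ltnS leq_eqVlt => /predU1P[->//|/h].
by rewrite h//; congr rcons; apply/ih => i /ltnW; exact: h.
Qed.

Lemma mkseq_leq (T : Type) (x y : nat -> T) m n :
  (m <= n)%N -> mkseq x n = mkseq y n -> mkseq x m = mkseq y m.
Proof.
by move=> mn /mkseq_eqP h; apply/mkseq_eqP => i im; apply: h; exact: leq_trans mn.
Qed.

Section perfect_information.
Context {A B : Type}.
Local Notation hist := (seq (A * B)).
Local Notation run := (nat -> A * B).
Implicit Types (x y : run) (P V : set run) (p q : hist).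

(** II answers with knowledge of I's move, so the replies are left unconstrained. As [s] reads the
    whole history, it remains a strategy from every extension of [p]. *)
Definition wins P p := exists s : hist -> A, forall x,
  mkseq x (size p) = p ->
  (forall k, (size p <= k)%N -> (x k).1 = s (mkseq x k)) -> P x.

Definition run_open V :=
  forall x, V x -> exists n, forall y, mkseq y n = mkseq x n -> V y.

Definition forces V p := forall x, mkseq x (size p) = p -> V x.

(** I plays [a], reads II's answer off the history and follows the strategy for that answer. *)
Lemma wins_rcons P p a : (forall b, wins P (rcons p (a, b))) -> wins P p.
Proof.
move=> /choice[s sP].
exists (fun h => if drop (size p) h is z :: _ then s z.2 h else a) => x xp xs.
have xE k : drop (size p) (mkseq x (size p + k)) =
            mkseq (fun i => x (size p + i)%N) k.
  rewrite /mkseq iotaD map_cat drop_size_cat ?size_map ?size_iota// add0n.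
    by rewrite -[in LHS](addn0 (size p)) iotaDl -map_comp.
have x0 : (x (size p)).1 = a.
  by rewrite xs// -[X in mkseq x X]addn0 xE.
have x1 : mkseq x (size p).+1 = rcons p (a, (x (size p)).2).
  by rewrite mkseqS xp -x0 -surjective_pairing.
apply: (sP (x (size p)).2); rewrite size_rcons// => k pk.
rewrite xs ?(ltnW pk)// -(subnKC pk) addSnnS xE /=.
by rewrite addn0.
Qed.

(* The strategy remembers the number n of switches made so far and the history
   q of the last one, and follows the strategy that is good for (n, q). *)
Lemma wins_switch P (N : set hist) (F : nat -> set hist) :
  (forall n q, N q -> wins [set x | P x \/ exists k,
     [/\ (size q < k)%N, F n (mkseq x k) & N (mkseq x k)]] q) ->
  (forall x, (forall n, exists k, F n (mkseq x k)) -> P x) ->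
  forall p, N p -> wins P p.
Proof.
move=> NF FP p Np.
have /choice[s sP] : forall nq : nat * hist, exists s : hist -> A, N nq.2 ->
    forall x, mkseq x (size nq.2) = nq.2 ->
    (forall k, (size nq.2 <= k)%N -> (x k).1 = s (mkseq x k)) ->
    P x \/ exists k, [/\ (size nq.2 < k)%N, F nq.1 (mkseq x k) & N (mkseq x k)].
  move=> -[n q] /=.
  have [Nq|nNq] := pselect (N q); first by have [s sq] := NF n q Nq; exists s.
  have [s _] := NF n p Np; by exists s => /nNq.
pose step (st : hist * (nat * hist)) z := let r := rcons st.1 z in
  (r, if `[< F st.2.1 r /\ N r >] then (st.2.1.+1, r) else st.2).
pose mem h := foldl step (p, (0%N, p)) (drop (size p) h).
exists (fun h => s (mem h).2 h) => x xp xs.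
pose M k := (mem (mkseq x (size p + k))).2.
have memS k : mem (mkseq x (size p + k.+1)) =
              step (mem (mkseq x (size p + k))) (x (size p + k)%N).
  by rewrite addnS mkseqS /mem drop_rcons ?size_mkseq ?leq_addr// foldl_rcons.
have mem0 : mem (mkseq x (size p + 0)) = (p, (0%N, p)).
  by rewrite addn0 xp /mem drop_size.
have mem1 k : (mem (mkseq x (size p + k))).1 = mkseq x (size p + k).
  elim: k => [|k ih]; first by rewrite mem0 addn0.
  by rewrite memS /= ih addnS mkseqS.
have MS k : M k.+1 = let r := mkseq x (size p + k.+1) in
    if `[< F (M k).1 r /\ N r >] then ((M k).1.+1, r) else M k.
  by rewrite /M memS /= mem1 addnS mkseqS.
have MN k : N (M k).2.
  elim: k => [|k ih]; first by rewrite /M mem0.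
  by rewrite MS /=; case: asboolP => // -[].
have Mle i k : (i <= k)%N -> ((M i).1 <= (M k).1)%N.
  move=> /subnKC <-; elim: (k - i)%N => [|j ih]; first by rewrite addn0.
  by rewrite addnS MS /=; case: asboolP => //= _; exact: leqW.
have Mq k : exists2 j, (j <= k)%N & (M k).2 = mkseq x (size p + j) /\
    forall i, (j <= i <= k)%N -> M i = M k.
  elim: k => [|k [j jk [Mk Mi]]].
    exists 0%N => //; rewrite {1}/M mem0 addn0 xp; split=> // i.
    by rewrite leqn0 => /eqP ->.
  rewrite [M k.+1]MS /=; case: asboolP => [FN|nFN].
    exists k.+1 => //; split=> // i; rewrite -eqn_leq => /eqP <-.
    by rewrite MS /= asboolT.
  exists j; first exact: leqW.
  split=> // i /andP[ji]; rewrite leq_eqVlt ltnS => /predU1P[->|ik].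
    by rewrite MS /= asboolF.
  by apply: Mi; rewrite ji.
have MF n k : (n < (M k).1)%N -> exists k', F n (mkseq x k').
  elim: k => [|k ih]; first by rewrite /M mem0.
  rewrite MS /=; case: asboolP => //= -[Fk _].
  rewrite ltnS leq_eqVlt => /predU1P[->|/ih//].
  by exists (size p + k.+1)%N.
(* With unboundedly many switches the run meets every [F n], hence is in [P]. Otherwise the counter
   has a maximum, after which the memory is constant. *)
have [unb|] := pselect (forall n, exists k, (n < (M k).1)%N).
  by apply: FP => n; have [k /MF] := unb n.
move=> /existsNP[n /forallNP bd].
have ex : exists m, `[< exists k, (M k).1 = m >].
  by exists (M 0%N).1; apply/asboolP; exists 0%N.
have bd' m : `[< exists k, (M k).1 = m >] -> (m <= n)%N.
  by move=> /asboolP[k <-]; rewrite leqNgt; apply/negP; exact: bd.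
have [m /asboolP[k kE] mmax] := ex_maxnP ex bd'.
have Mc i : M (k + i)%N = M k.
  elim: i => [|i ih]; first by rewrite addn0.
  have : ((M (k + i.+1)).1 <= m)%N.
    by apply: mmax; apply/asboolP; exists (k + i.+1)%N.
  rewrite addnS MS ih /=; case: asboolP => //= _.
  by rewrite kE ltnn.
have [j jk [qE Mj]] := Mq k.
have Mi i : (j <= i)%N -> M i = M k.
  move=> ji; have [ik|ki] := leqP i k; first by apply: Mj; rewrite ji.
  by rewrite -(subnKC (ltnW ki)) Mc.
have sq : size (M k).2 = (size p + j)%N by rewrite qE size_mkseq.
(* From the last switch on, the run follows one fixed strategy, which yields [P] or a further
   switch; the latter is excluded. *)
have [|i|//|[i [qi Fi Ni]]] := sP (M k) (MN k) x; first by rewrite sq qE.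
  rewrite sq => ji; have pi := leq_trans (leq_addr _ _) ji.
  rewrite xs//; congr (s _ _); rewrite -(Mi (i - size p)%N).
    by rewrite /M subnKC.
  by rewrite -(leq_add2l (size p)) subnKC.
move: qi Fi Ni; rewrite sq.
case: i => // i; rewrite ltnS => ji Fi Ni.
have pi := leq_trans (leq_addr _ _) ji.
have ji' : (j <= i - size p)%N by rewrite -(leq_add2l (size p)) subnKC.
have := MS (i - size p)%N; rewrite !Mi ?(leqW ji')//= addnS subnKC// asboolT//.
by move=> /(congr1 fst)/= /n_Sn.
Qed.

(* Call p good when it satisfies the conclusion.  From a position that is not
   good, player I can for each n either win or reach a position that is again
   not good and forces U n; doing so for all n in turn wins as well. *)
Lemma gdelta_avoid P (U : nat -> set run) p :
  (forall n, run_open (U n)) -> (forall x, (forall n, U n x) -> P x) ->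
  ~ wins P p -> exists V, [/\ run_open V,
    forall x, mkseq x (size p) = p -> (forall n, U n x) -> V x &
    ~ wins (P `|` V) p].
Proof.
move=> oU UP; pose good q := exists V, [/\ run_open V,
    forall x, mkseq x (size q) = q -> (forall n, U n x) -> V x &
    ~ wins (P `|` V) q].
apply: contra_notP => ngood.
apply: (@wins_switch P (fun q => ~ good q) (fun n => forces (U n))) ngood.
  have /choice[W WP] : forall q, exists V, good q -> [/\ run_open V,
      forall x, mkseq x (size q) = q -> (forall n, U n x) -> V x &
      ~ wins (P `|` V) q].
    move=> q.
    by have [[V VP]|ng] := pselect (good q); [exists V|exists setT => /ng].
  move=> n q ngq; apply: contrapT => nwin; apply: ngq.
  pose first x k := [/\ (size q < k)%N, forces (U n) (mkseq x k) &
    forall j, (size q < j < k)%N -> ~ forces (U n) (mkseq x j)].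
  (* A run is in [V] if it has a first position past [q] forcing [U n] and, when that position is
     good, also lies in its witness [W]. If I could not reach the goal of the n-th switch from [q],
     this [V] would make [q] good. *)
  pose V := [set x | exists k, first x k /\ 
    (good (mkseq x k) -> W (mkseq x k) x)].
  have first_mkseq x y k m : (k <= m)%N -> mkseq y m = mkseq x m ->
      first x k -> first y k.
    move=> km yx [qk Fk nF]; have yx' i : (i <= k)%N -> mkseq y i = mkseq x i.
      by move=> ik; apply: mkseq_leq yx; exact: leq_trans km.
    split=> //; first by rewrite yx'.
    by move=> j /[dup] jk /nF; rewrite yx'//; case/andP: jk => _ /ltnW.
  have first_uniq x i j : first x i -> first x j -> i = j.
    move=> [qi Fi nFi] [qj Fj nFj]; case: (ltngtP i j) => // ij.
      by have := nFj i; rewrite qi ij => /(_ isT Fi).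
    by have := nFi j; rewrite qj ij => /(_ isT Fj).
  have first_ex x k : (size q < k)%N -> forces (U n) (mkseq x k) ->
      exists k', first x k'.
    move=> qk Fk.
    have ex : exists k, `[< (size q < k)%N /\ forces (U n) (mkseq x k) >].
      by exists k; apply/asboolP.
    have [m /asboolP[qm Fm] mmin] := ex_minnP ex.
    exists m; split; [exact: qm|exact: Fm|move=> j /andP[qj jm] Fj].
    by have := mmin j (asboolT (conj qj Fj)); rewrite leqNgt jm.
  exists V; split.
  - move=> x [k [xk gk]].
    have [g|ng] := pselect (good (mkseq x k)).
      have [oW _ _] := WP _ g.
      have [m mW] := oW x (gk g).
      exists (maxn m k) => y yx; exists k; split.
        by apply: first_mkseq yx xk; exact: leq_maxr.
      have -> : mkseq y k = mkseq x k by apply: mkseq_leq yx; exact: leq_maxr.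
      by move=> _; apply: mW; apply: mkseq_leq yx; exact: leq_maxl.
    exists k => y yx; exists k; split; first exact: first_mkseq yx xk.
    by rewrite yx.
  - move=> x xq Ux; have [m mU] := oU n x (Ux n).
    have [||k xk] := first_ex x (maxn m (size q).+1).
    + exact: leq_maxr.
    + move=> y; rewrite size_mkseq => yx; apply: mU; apply: mkseq_leq yx.
      exact: leq_maxl.
    exists k; split=> // /WP[_ h _]; apply: h => //.
    by rewrite size_mkseq.
  (* Winning [P] or [V] from [q] achieves that goal: at a good first position the same strategy
     would win [P] or [W], against the choice of [W]. *)
  - move=> [s sP]; apply: nwin; exists s => x xq xs.
    have [|[k [xk gk]]] := sP x xq xs; first by left.
    have [g|ng] := pselect (good (mkseq x k)); last first.
      by right; exists k; case: xk.
    have [_ _ []] := WP _ g; exists s => y; rewrite size_mkseq => yx ys.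
    have [qk _ _] := xk.
    have yk : first y k by apply: first_mkseq yx xk.
    have yq : mkseq y (size q) = q by rewrite -[RHS]xq; apply: mkseq_leq yx; exact: ltnW.
    have [||Py|[k' [yk' gk']]] := sP y.
    + exact: yq.
    + move=> i qi; have [ki|ik] := leqP k i; first exact: ys.
      have <- : x i = y i by move/mkseq_eqP: yx => ->.
      rewrite xs//; congr s; apply/esym; apply: mkseq_leq yx; exact: ltnW.
    + by left.
    + right; move: (first_uniq _ _ _ yk yk') gk' => <-; rewrite yx; exact.
move=> x Fx; apply: UP => n; have [k] := Fx n; apply.
by rewrite size_mkseq.
Qed.

(** II maintains an open [V] such that I does not win the union of [P] and [V], enlarging it in
    round n to cover the n-th G_delta set. A run in [P] would enter some [V], hence be forced into
    it at a finite stage, where I wins trivially. *)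
Theorem gdelta_sigma_determinacy (U : nat -> nat -> set run) :
  (forall i n, run_open (U i n)) ->
  let P := [set x | exists i, forall n, U i n x] in
  wins P [::] \/ exists t : hist -> A -> B, forall x,
    (forall k, (x k).2 = t (mkseq x k) (x k).1) -> ~ P x.
Proof.
move=> oU P; have [|nwin] := pselect (wins P [::]); [by left|right].
pose inv p V := run_open V /\ ~ wins (P `|` V) p.
have /choice[f0 f0P] : forall pVa : hist * set run * A, exists bV : B * set run,
  let: (pV, a) := pVa in
    inv pV.1 pV.2 -> let p := rcons pV.1 (a, bV.1) in [/\ inv p bV.2,
    pV.2 `<=` bV.2 & forall x, mkseq x (size p) = p ->
    (forall n, U (size pV.1) n x) -> bV.2 x].
  move=> [[p V] a].
  (* Without moves for II there would be no runs, and I would win vacuously. *)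
  have b0 : exists b : B, True.
    apply: contrapT => nb; apply: nwin.
    by exists (fun=> a) => x; case: nb; exists (x 0%N).2.
  have [[oV nw]|ni] := pselect (inv p V); last first.
    by have [b _] := b0; exists (b, setT) => /ni.
  have [b nwb] : exists b, ~ wins (P `|` V) (rcons p (a, b)).
    by apply/existsNP => h; apply: nw; exact: wins_rcons h.
  have [|V' [oV' UV' nV']] := gdelta_avoid (oU (size p)) _ nwb.
    by move=> x Ux; left; exists (size p).
  exists (b, V `|` V') => _; split.
  - split; last by rewrite /= setUA.
    by move=> x [/oV|/oV'] [n nV]; exists n => y /nV; [left|right].
  - by move=> x; left.
  - by move=> x xp Ux; right; exact: UV'.
pose f pV a := f0 (pV, a); have fP pV a := f0P (pV, a).
pose step (pV : hist * set run) z := (rcons pV.1 z, (f pV z.1).2).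
pose mem h := foldl step ([::], set0) h.
exists (fun h a => (f (mem h) a).1) => x xt.
pose V k := (mem (mkseq x k)).2.
have memE k : mem (mkseq x k) = (mkseq x k, V k).
  rewrite [LHS]surjective_pairing; congr pair.
  by elim: k => // k ih; rewrite mkseqS /mem foldl_rcons /= [X in rcons X _]ih.
have VS k : V k.+1 = (f (mkseq x k, V k) (x k).1).2.
  by rewrite /V mkseqS /mem foldl_rcons /= -/(mem _) memE.
have xk k : rcons (mkseq x k) ((x k).1, (f (mkseq x k, V k) (x k).1).1) = mkseq x k.+1.
  by rewrite mkseqS; congr rcons; rewrite -memE -xt -surjective_pairing.
have invk k : inv (mkseq x k) (V k).
  elim: k => [|k /(fP (mkseq x k, V k) (x k).1)].
    by rewrite /V /=; split=> // ; rewrite setU0.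
  by rewrite /= -/(f _ _) xk -VS => -[].
have Vsub k : V k `<=` V k.+1.
  have := fP (mkseq x k, V k) (x k).1 (invk k).
  by rewrite /= -/(f _ _) -VS => -[].
have VU k : (forall n, U k n x) -> V k.+1 x.
  have := fP (mkseq x k, V k) (x k).1 (invk k).
  rewrite /= -/(f _ _) -VS xk => -[_ _ /(_ x)]; rewrite !size_mkseq; exact.
have Vle i k : (i <= k)%N -> V i `<=` V k.
  move=> /subnKC <-; elim: (k - i)%N => [|j ih]; first by rewrite addn0.
  by rewrite addnS; exact: subset_trans (Vsub _).
move=> [i /VU Vx]; have [m mV] := (invk i.+1).1 x Vx.
case: (invk (maxn m i.+1)) => _; apply.
exists (fun=> (x 0%N).1) => y; rewrite size_mkseq => yx _; right.
apply: (Vle i.+1); first exact: leq_maxr.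
by apply: mV; apply: mkseq_leq yx; exact: leq_maxl.
Qed.

End perfect_information.

(** * Approximate minimax theorem *)

Section minimax.
Context {R : realType}.

Lemma fdist_dirac_subproof (T : finType) (a : T) : \sum_x (x == a)%:R = 1 :> R.
Proof.
by rewrite (bigD1 a)//= eqxx big1 ?addr0// => x /negbTE ->.
Qed.

Definition fdist_dirac (T : finType) (a : T) : fdist R T :=
  FDist (fun x => ler0n R (x == a)) (fdist_dirac_subproof a).

Lemma fdist_expect_le (T : finType) (t : fdist R T) (u : T -> R) a :
  (forall x, u x <= a) -> \sum_x t x * u x <= a.
Proof.
move=> ua; rewrite -[leRHS]mul1r -(fdist_sum1 t) big_distrl /=.
by apply: ler_sum => x _; rewrite ler_wpM2l// fdist_ge0.
Qed.

Lemma fdist_expect_const (T : finType) (t : fdist R T) (a : R) :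
  \sum_x t x * a = a.
Proof. by rewrite -big_distrl /= fdist_sum1 mul1r. Qed.

Lemma fdist_expectD (T : finType) (t : fdist R T) (u : T -> R) a :
  \sum_x t x * (u x + a) = \sum_x t x * u x + a.
Proof.
under eq_bigr do rewrite mulrDr.
by rewrite big_split /= fdist_expect_const.
Qed.

Context {X Y : finType}.

Section mixture.
Variables (t : fdist R Y) (a : R) (y : Y).
Hypotheses (a0 : 0 <= a) (a1 : a <= 1).

Let mix y' : R := (1 - a) * t y' + a * fdist_dirac y y'.

Let mix_ge0 y' : 0 <= mix y'.
Proof. by rewrite addr_ge0// mulr_ge0 ?fdist_ge0// subr_ge0. Qed.

Let mix_sum1 : \sum_y' mix y' = 1.
Proof. by rewrite big_split/= -!big_distrr/= fdist_sum1 fdist_dirac_subproof; ring. Qed.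

Definition fdist_mix : fdist R Y := FDist mix_ge0 mix_sum1.

Lemma fdist_mixE (u : Y -> R) :
  \sum_y' fdist_mix y' * u y' = (1 - a) * \sum_y' t y' * u y' + a * u y.
Proof.
rewrite /= /mix; under eq_bigr do rewrite mulrDl -!mulrA.
rewrite big_split/= -!big_distrr/=; congr (_ + _ * _).
by rewrite (bigD1 y)//= eqxx mul1r big1 ?addr0// => y' /negbTE ->; rewrite mul0r.
Qed.

End mixture.

(* If r_x is the positive part of the excess of t over c in row x, then r,
   suitably normalised, is a good strategy for the row player as soon as t
   nearly minimises the sum of the squares of the r_x: moving t slightly towards
   a column y cannot decrease that sum by much. *)
Lemma minimax_alternative (h : X -> Y -> R) (c : R) (y0 : Y) :
  (exists s : fdist R X, forall y, c <= \sum_x s x * h x y) \/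
  (forall d, 0 < d ->
    exists t : fdist R Y, forall x, \sum_y t y * h x y <= c + d).
Proof.
pose e (t : fdist R Y) x := \sum_y t y * h x y - c.
pose r t x := Num.max 0 (e t x).
pose f t := \sum_x r t x ^+ 2.
have r0 t x : 0 <= r t x by rewrite /r le_max lexx.
have f0 t : 0 <= f t by apply: sumr_ge0 => x _; exact: sqr_ge0.
pose E := range f.
have hE : has_inf E.
  split; first by exists (f (fdist_dirac y0)); exists (fdist_dirac y0).
  by exists 0 => _ [t _ <-].
pose m := inf E.
have fm t : m <= f t by apply: ge_inf => //; [exact: hE.2|exists t].
have : 0 <= m by apply: lb_le_inf; [exact: hE.1|move=> _ [t _ <-]].
rewrite le_eqVlt => /predU1P[m0|m0].
  (* Each squared positive excess is at most [f t], so [f t < d ^+ 2] keeps every excess below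
     [d]. *)
  right=> d d0; have d20 : 0 < d ^+ 2 by rewrite exprn_gt0.
  have [_ [t _ <-]] := inf_adherent d20 hE.
  rewrite -/m -m0 add0r => ftd; exists t => x.
  suff : e t x <= d by rewrite /e lerBlDl.
  rewrite leNgt; apply/negP => dx; move: ftd; apply/negP; rewrite -leNgt.
  rewrite /f (bigD1 x)//= -[leLHS]addr0 lerD//; last first.
    by apply: sumr_ge0 => i _; exact: sqr_ge0.
  have dr : d <= r t x by rewrite /r le_max (ltW dx) orbT.
  by rewrite lerXn2r// nnegrE// ltW.
left.
pose K := \sum_x \sum_y `|h x y - c|.
have K0 : 0 <= K by apply: sumr_ge0 => x _; apply: sumr_ge0.
have hK x y : `|h x y - c| <= K.
  rewrite /K (bigD1 x)//= (bigD1 y)//= -addrA lerDl addr_ge0//.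
    exact: sumr_ge0.
  by apply: sumr_ge0 => i _; exact: sumr_ge0.
have eE t x : e t x = \sum_y t y * (h x y - c).
  by rewrite fdist_expectD.
have eK t x : `|e t x| <= K.
  rewrite eE; apply: (le_trans (ler_norm_sum _ _ _)).
  under eq_bigr do rewrite normrM ger0_norm ?fdist_ge0//.
  exact: fdist_expect_le.
(* [M] bounds the second-order term of [f] along a mixture; the weight [a] is chosen with
   [a * M < m]. *)
pose M := \sum_(x : X) (K + K) ^+ 2.
have M0 : 0 <= M by apply: sumr_ge0 => x _; exact: sqr_ge0.
pose a := Num.min 1 (m / (M + 1)).
have a0 : 0 < a by rewrite lt_min ltr01 divr_gt0// ltr_wpDl.
have a1 : a <= 1 by rewrite ge_min lexx.
have aM : a * M < m.
  have : a <= m / (M + 1) by rewrite ge_min lexx orbT.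
  rewrite ler_pdivlMr ?ltr_wpDl// mulrDr mulr1 => h1.
  by apply: lt_le_trans h1; rewrite ltrDl.
have [_ [t _ <-] ft] := inf_adherent (mulr_gt0 a0 m0) hE.
have step y : f (fdist_mix t y (ltW a0) a1) <= f t
     + a * (2 * \sum_x r t x * (h x y - c - e t x)) + a ^+ 2 * M.
  pose b x := h x y - c - e t x.
  have -> : f t + a * (2 * \sum_x r t x * b x) + a ^+ 2 * M =
      \sum_x (r t x ^+ 2 + a * (2 * (r t x * b x)) + a ^+ 2 * (K + K) ^+ 2).
    by rewrite /f /M !big_distrr/= -!big_split.
  apply: ler_sum => x _.
  have eb : e (fdist_mix t y (ltW a0) a1) x = e t x + a * b x.
    by rewrite {1}/e fdist_mixE /b /e; ring.
  apply: (@le_trans _ _ ((r t x + a * b x) ^+ 2)).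
    rewrite {1}/r eb /Num.max; case: ltP => ineq; last by rewrite expr0n sqr_ge0.
    have er : e t x <= r t x by rewrite /r le_max lexx orbT.
    by rewrite lerXn2r// ?nnegrE ?(ltW ineq)// ?lerD2r// (le_trans (ltW ineq))// lerD2r.
  have -> : (r t x + a * b x) ^+ 2 =
    r t x ^+ 2 + a * (2 * (r t x * b x)) + a ^+ 2 * b x ^+ 2 by ring.
  rewrite lerD2l ler_wpM2l ?sqr_ge0//.
  rewrite -(real_normK (num_real (b x))) lerXn2r ?nnegrE ?addr_ge0//.
  by rewrite (le_trans (ler_normB _ _))// lerD.
have rr : \sum_x r t x * e t x = f t.
  apply: eq_bigr => x _; rewrite expr2 /r /Num.max.
  by case: ltP => _; rewrite ?mul0r.
(* Comparing [m] with [f] at the mixture and dividing by [a] gives [0 <= m + 2 * (G - f t) + a * M];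
   now [m <= f t] and [a * M < m] make [G] nonnegative. *)
have good y : 0 <= \sum_x r t x * (h x y - c).
  have := le_trans (fm (fdist_mix t y (ltW a0) a1)) (step y).
  have -> : \sum_x r t x * (h x y - c - e t x) =
    \sum_x r t x * (h x y - c) - f t.
    by rewrite -rr -sumrB; apply: eq_bigr => x _; rewrite mulrBr.
  set G := \sum_x _ => ineq.
  have fmt := fm t.
  have h1 : 0 <= a * m + a * (2 * (G - f t)) + a ^+ 2 * M.
    by rewrite -/m in ft; lra.
  have h2 : 0 <= a * (m + 2 * (G - f t) + a * M).
    by move: h1; congr (_ <= _); ring.
  by rewrite pmulr_rge0// in h2; lra.
pose w := \sum_x r t x.
have w0 : 0 < w.
  rewrite lt_neqAle sumr_ge0// andbT; apply/eqP => w0.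
  have rz x : r t x = 0.
    by apply/eqP; move/esym/eqP: w0; rewrite psumr_eq0// => /allP/(_ x);
      rewrite mem_index_enum; apply.
  have := fm t; rewrite /f big1 ?leNgt ?m0// => x _.
  by rewrite rz expr0n.
have s0 x : 0 <= r t x / w by rewrite divr_ge0// ltW.
have s1 : \sum_x r t x / w = 1 by rewrite -big_distrl/= divff// gt_eqF.
exists (FDist s0 s1) => y /=.
rewrite -subr_ge0.
have -> : \sum_x r t x / w * h x y - c = (\sum_x r t x * (h x y - c)) / w.
  rewrite -{1}[c]mul1r -s1 !big_distrl/= -sumrB; apply: eq_bigr => x _; ring.
by rewrite divr_ge0// ltW.
Qed.

End minimax.

(** * The space of plays and Ville's inequality *)

(** The plays sharing n rounds with [w] form a filter base. Its filter converges to [w] in the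
    product topology, since each coordinate is eventually fixed. *)
Lemma open_play (X Y : finType) (U : set (play X Y)) (w : play X Y) :
  open U -> U w -> exists n, forall v : play X Y, mkseq v n = mkseq w n -> U v.
Proof.
pose F := filter_from [set: nat] (fun n => [set v : play X Y | mkseq v n = mkseq w n]).
have FF : Filter F.
  apply: filter_from_filter; first by exists 0%N.
  move=> i j _ _; exists (maxn i j) => // v /= vw.
  by split; apply: mkseq_leq vw; rewrite ?leq_maxl ?leq_maxr.
suff Fw : F --> w by move=> oU Uw; have [|n _ nU] := Fw U; [exact: open_nbhs_nbhs|exists n].
apply/(@cvg_sup _ _ (fun i => Topological.class (initial_topology
  (fun f : play X Y => f i)))) => i.
apply/cvg_image; first by apply/seteqP; split => // z _; exists (fun=> z).
move=> V /nbhs_singleton Vwi; exists [set v : play X Y | V (v i)].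
  by exists i.+1 => // v /mkseq_eqP h /=; rewrite h.
by apply/seteqP; split => [_ [v Vv <-]//|z Vz]; exists (fun=> z).
Qed.

Lemma cylinder_open (X Y : finType) (p : position X Y) : open (cylinder p).
Proof.
rewrite openE => w wp; rewrite /cylinder -wp /= /play_prefix size_mkseq.
elim: (size p) => [|n ih]; first by apply: filterS filterT.
have : nbhs w [set v : play X Y | v n = w n].
  exact: (@proj_continuous _ (fun=> discrete_topology (X * Y)%type) n w _
    (discrete_set1 _)).
by apply: filterS2 ih => v /= vw vn; rewrite /play_prefix !mkseqS vn; congr rcons.
Qed.

Section ville.
Context {R : realType} {X Y : pointedFinType}.
Implicit Types (p : position X Y) (Q : set (position X Y)).

Lemma cylinder_measurable p : measurable (cylinder p).
Proof. by apply: sub_sigma_algebra; exact: cylinder_open. Qed.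

Lemma visits_measurable Q :
  measurable [set w : play X Y | exists k, Q (mkseq w k)].
Proof.
have -> : [set w : play X Y | exists k, Q (mkseq w k)] =
    \bigcup_(p in Q) cylinder p.
  apply/seteqP; split => [w [k Qk]|w [p Qp wp]].
    by exists (mkseq w k) => //; rewrite /cylinder /= size_mkseq.
  by have e : mkseq w (size p) = p := wp; exists (size p); rewrite /= e.
rewrite bigcup_mkcond; apply: countable_bigcupT_measurable.
  exact: (@countableP (seq (X * Y))).
move=> p; case: ifPn => _; first exact: cylinder_measurable.
exact: measurable0.
Qed.

Lemma Gdelta_play_measurable (S : set (play X Y)) : Gdelta S -> measurable S.
Proof.
move=> [U oU ->]; apply: bigcapT_measurable => i.
exact: sub_sigma_algebra.
Qed.

Variables (s : strategyI R X Y) (t : strategyII R X Y).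

Lemma position_weight_ge0 p : 0 <= position_weight s t p.
Proof. by apply: prodr_ge0 => i _; rewrite mulr_ge0 ?fdist_ge0. Qed.

Lemma position_weight_rcons p z : position_weight s t (rcons p z) =
  position_weight s t p * (s p z.1 * t p z.2).
Proof.
rewrite /position_weight size_rcons big_ord_recr /=; congr (_ * _).
  apply: eq_bigr => i _.
  by rewrite nth_rcons ltn_ord -cats1 takel_cat// ltnW.
by rewrite nth_rcons ltnn eqxx -cats1 take_size_cat.
Qed.

(** Induction on n bounds the probability of passing through [p] and reaching level 1 within n
    further rounds by the weight of [p] times [g p]. Continuity from below then removes the bound on
    n. *)
Lemma ville_inequality (g : position X Y -> R) : (forall p, 0 <= g p) ->
  (forall p, \sum_z s p z.1 * t p z.2 * g (rcons p z) <= g p) ->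
  (play_measure s t [set w | exists k, (1 <= g (mkseq w k))%R] <= (g [::])%:E)%E.
Proof.
move=> g0 gS; pose mu := play_measure s t.
pose hit p n := cylinder p `&` [set w : play X Y | exists k,
  (size p <= size (mkseq w k) <= size p + n)%N && (1 <= g (mkseq w k))].
have mhit p n : measurable (hit p n).
  apply: measurableI; first exact: cylinder_measurable.
  exact: (visits_measurable [set q | (size p <= size q <= size p + n)%N && (1 <= g q)]).
have key n p : (mu (hit p n) <= (position_weight s t p * g p)%:E)%E.
  elim: n p => [|n ih] p.
    have [gp|gp] := leP 1 (g p).
      apply: (@le_trans _ _ (mu (cylinder p))).
        by apply: le_measure; rewrite ?inE//; [exact: cylinder_measurable|exact: subIsetl].
      rewrite play_measureE lee_fin ler_peMr//.
      exact: position_weight_ge0.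
    suff -> : hit p 0 = set0.
      by rewrite measure0 lee_fin mulr_ge0// position_weight_ge0.
    apply/seteqP; split => // w [/[dup] wp]; rewrite /cylinder /= /play_prefix => e [k].
    rewrite addn0 size_mkseq -eqn_leq.
    move=> /andP[/eqP <-]; by rewrite e leNgt gp.
  have [gp|gp] := leP 1 (g p).
    apply: (@le_trans _ _ (mu (cylinder p))).
      by apply: le_measure; rewrite ?inE//; [exact: cylinder_measurable|exact: subIsetl].
    by rewrite play_measureE lee_fin ler_peMr// position_weight_ge0.
  have sub : hit p n.+1 `<=` \bigcup_(z in [set: X * Y]) hit (rcons p z) n.
    move=> w [/[dup] wp]; rewrite /cylinder /= /play_prefix => e [k].
    rewrite size_mkseq => /andP[/andP[]].
    rewrite leq_eqVlt => /predU1P[<- _|pk kn gk].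
      by rewrite e leNgt gp.
    exists (w (size p)) => //; split.
      by rewrite /cylinder /= size_rcons /play_prefix mkseqS; congr rcons.
    by exists k; rewrite size_mkseq size_rcons pk gk addSnnS kn.
  have fin : finite_set [set: X * Y] by exact: finite_finset.
  apply: (le_trans (content_sub_fsum mu fin _ (mhit _ _) sub)) => //.
  have -> : (\sum_(z \in [set: X * Y]) mu (hit (rcons p z) n) =
             \sum_z mu (hit (rcons p z) n))%E.
    rewrite fsbig_finite//=; apply: perm_big; apply: uniq_perm.
    - exact: finmap.fset_uniq.
    - exact: index_enum_uniq.
    - by move=> z; rewrite mem_index_enum in_fset_set//; apply: mem_set.
  apply: le_trans (lee_sum _ (fun z _ => ih (rcons p z))) _.
  rewrite sumEFin lee_fin.
  under eq_bigr do rewrite position_weight_rcons -mulrA.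
  by rewrite -big_distrr/= ler_wpM2l// position_weight_ge0.
have tgt : [set w : play X Y | exists k, 1 <= g (mkseq w k)] =
    \bigcup_n hit [::] n.
  apply/seteqP; split => [w [k gk]|w [n _ [_ [k /andP[_ gk]]]]]; last by exists k.
  by exists k => //; split=> //; exists k; rewrite size_mkseq leqnn gk.
have nd : {homo hit [::] : n m / (n <= m)%N >-> (n <= m)%O}.
  move=> n m nm; apply/subsetPset => w [wp [k /andP[/andP[h1 h2] gk]]].
  by split=> //; exists k; rewrite h1 gk (leq_trans h2)// leq_add2l.
have cv := nondecreasing_cvg_mu (mu := mu) (mhit [::]) (bigcupT_measurable _ (mhit [::])) nd.
rewrite tgt -(cvg_lim _ cv)//; apply: lime_le.
  by apply/cvg_ex; eexists; exact: cv.
near=> n; rewrite /=; apply: le_trans (key n [::]) _.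
by rewrite /position_weight big_ord0 mul1r.
Unshelve. all: end_near. Qed.

End ville.

(** * The auxiliary game *)

Section consistent_histories.
Context {A B : Type}.
Local Notation hist := (seq (A * B)).
Variable t : hist -> A -> B.

Inductive consistent : hist -> Prop :=
| consistent_nil : consistent [::]
| consistent_rcons q a : consistent q -> consistent (rcons q (a, t q a)).

(** Replaying I's moves in [q] against [t], and [a0] once they are exhausted, gives a full run, to
    which a winning condition applies. *)
Lemma consistent_run (a0 : A) q : consistent q ->
  exists2 x : nat -> A * B, mkseq x (size q) = q &
    forall k, (x k).2 = t (mkseq x k) (x k).1.
Proof.
pose m (Q h : hist) := if drop (size h) Q is z :: _ then z.1 else a0 : A.
pose G (Q : hist) n := iter n (fun h => rcons h (m Q h, t h (m Q h))) [::].
have GE Q n : mkseq (fun k => (m Q (G Q k), t (G Q k) (m Q (G Q k)))) n = G Q n.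
  by elim: n => // n ih; rewrite mkseqS ih.
move=> cq; exists (fun k => (m q (G q k), t (G q k) (m q (G q k)))); last first.
  by move=> k; rewrite GE.
rewrite GE; suff h r Q : consistent r -> (exists r', Q = r ++ r') ->
    G Q (size r) = r by apply: h => //; exists [::]; rewrite cats0.
elim=> // {}r a cr ih [r' QE].
rewrite size_rcons /G /= -/(G Q (size r)) ih; last first.
  by exists ((a, t r a) :: r'); rewrite QE cat_rcons.
by have -> : m Q r = a by rewrite /m QE cat_rcons drop_size_cat.
Qed.

End consistent_histories.

Section martin_game.
Context {R : realType} {X Y : pointedFinType}.
Local Notation Z := (X * Y)%type.
Local Notation move := (Z -> R).
Local Notation hist := (seq (move * Z)).
Implicit Types (q : hist) (h : move) (p : position X Y).

Lemma expect_pair (s : fdist R X) (t : fdist R Y) (F : Z -> R) :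
  \sum_z s z.1 * t z.2 * F z = \sum_x s x * \sum_y t y * F (x, y).
Proof.
rewrite (eq_bigr (fun z => s z.1 * t z.2 * F (z.1, z.2))); last by case.
rewrite -(pair_bigA _ (fun x y => s x * t y * F (x, y))) /=.
by apply: eq_bigr => x _; rewrite big_distrr/=; apply: eq_bigr => y _; rewrite mulrA.
Qed.

Lemma expect_pair_exchange (s : fdist R X) (t : fdist R Y) (F : Z -> R) :
  \sum_z s z.1 * t z.2 * F z = \sum_y t y * \sum_x s x * F (x, y).
Proof.
rewrite (eq_bigr (fun z => s z.1 * t z.2 * F (z.1, z.2))); last by case.
rewrite -(pair_bigA _ (fun x y => s x * t y * F (x, y))) /= exchange_big /=.
apply: eq_bigr => y _; rewrite big_distrr/=; apply: eq_bigr => x _.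
by rewrite mulrCA mulrA.
Qed.

(** A mixed move of I securing [c] expresses that the matrix game [h] has value at least [c]. *)
Definition admissible h (c : R) := (forall z, 0 <= h z <= 1) /\
  exists s : fdist R X, forall y, c <= \sum_x s x * h (x, y).

(* An inadmissible move is replaced by the constant c, so that every move of the
   auxiliary game is legal. *)
Definition legal h (c : R) : move := if `[< admissible h c >] then h else fun=> c.

Lemma legal_admissible h c : 0 <= c <= 1 -> admissible (legal h c) c.
Proof.
move=> c01; rewrite /legal; case: asboolP => // _; split=> //.
by exists (fdist_dirac point) => y; rewrite fdist_expect_const.
Qed.

Variables (S : set (play X Y)) (v : R).
Hypothesis v01 : 0 <= v <= 1.

Definition score q : R := foldl (fun c a => legal a.1 c a.2) v q.

Lemma score_rcons q h z : score (rcons q (h, z)) = legal h (score q) z.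
Proof. exact: foldl_rcons. Qed.

Lemma score01 q : 0 <= score q <= 1.
Proof.
elim/last_ind: q => // q [h z] ih; rewrite score_rcons.
by have [h01 _] := legal_admissible h ih.
Qed.

Definition martin_win : set (nat -> move * Z) :=
  [set x | S ((fun k => (x k).2) : play X Y) \/
           exists k, score (mkseq x k) = 0].

Lemma martin_lower : measurable S -> wins martin_win [::] ->
  exists s : strategyI R X Y, forall t : strategyII R X Y,
    (v%:E <= play_measure s t S)%E.
Proof.
move=> mS [m mP].
pose H p := foldl (fun q z => rcons q (m q, z)) [::] p.
have HS p z : H (rcons p z) = rcons (H p) (m (H p), z) by exact: foldl_rcons.
have /choice[s sP] : forall p, exists s : fdist R X, forall y,
    score (H p) <= \sum_x s x * score (H (rcons p (x, y))).
  move=> p; have [_ [s sy]] := legal_admissible (m (H p)) (score01 (H p)).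
  exists s => y; apply: le_trans (sy y) _.
  by under eq_bigr do rewrite -score_rcons -HS.
exists s => t.
(* Under [s] this is a nonnegative supermartingale, and it reaches 1 exactly when the score reaches
   0. *)
pose g p := 1 - score (H p).
have gE : [set w : play X Y | exists k, 1 <= g (mkseq w k)] =
          [set w : play X Y | exists k, score (H (mkseq w k)) = 0].
  apply/seteqP; split=> w [k wk]; exists k; move: wk => /=.
    rewrite /g -subr_ge0 addrAC subrr add0r oppr_ge0 => c0.
    by apply/eqP; rewrite eq_le c0; case/andP: (score01 (H (mkseq w k))).
  by rewrite /g => ->; rewrite subr0.
pose N := [set w : play X Y | exists k, score (H (mkseq w k)) = 0].
have mN : measurable N.
  exact: (visits_measurable [set p | score (H p) = 0]).
have NV : (play_measure s t N <= (1 - v)%:E)%E.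
  rewrite /N -gE -[1 - v]/(g [::]); apply: ville_inequality => p.
    by rewrite subr_ge0; case/andP: (score01 (H p)).
  rewrite /g expect_pair_exchange.
  have -> : \sum_y t p y * \sum_x s p x * (1 - score (H (rcons p (x, y)))) =
      1 - \sum_y t p y * \sum_x s p x * score (H (rcons p (x, y))).
    under eq_bigr do under eq_bigr do rewrite mulrBr mulr1.
    under eq_bigr do rewrite sumrB fdist_sum1 mulrBr mulr1.
    by rewrite sumrB fdist_sum1.
  rewrite lerD2l lerN2 -{1}(fdist_expect_const (t p) (score (H p))).
  by apply: ler_sum => y _; rewrite ler_wpM2l ?fdist_ge0.
have NS : ~` N `<=` S.
  move=> w Nw; pose x k := (m (H (mkseq w k)), w k).
  have xE k : mkseq x k = H (mkseq w k).
    by elim: k => // k ih; rewrite !mkseqS HS ih.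
  have [//|k _|//|[k c0]] := mP x; first by rewrite /= xE.
  by exfalso; apply: Nw; exists k; rewrite -xE.
apply: (@le_trans _ _ (play_measure s t (~` N))); last first.
  by apply: le_measure; rewrite ?inE//; exact: measurableC.
rewrite probability_setC//.
have Nfin : play_measure s t N \is a fin_num by exact: fin_num_measure.
move: NV; rewrite -(fineK Nfin) -EFinB !lee_fin /score /=.
by rewrite lerBrDl -lerBrDr.
Qed.

(** II accompanies the play by an auxiliary history consistent with [m]: after [z] it is extended by
    a move that [m] answers with [z] and whose new score is close to the infimum [u]. *)
Lemma martin_upper (m : hist -> move -> Z) (e : R) : measurable S -> 0 < e ->
  (forall x, (forall k, (x k).2 = m (mkseq x k) (x k).1) -> ~ martin_win x) ->
  exists t : strategyII R X Y, forall s : strategyI R X Y,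
    (play_measure s t S <= (v + e)%:E)%E.
Proof.
move=> mS e0 mP.
have score_neq0 q : consistent m q -> score q <> 0.
  move=> /(@consistent_run _ _ m (fun=> 0))[x xq xm] q0.
  by apply: (mP x xm); right; exists (size q); rewrite xq.
pose K q z := [set legal h (score q) z | h in [set h | m q h = z]].
pose u q z := if `[< K q z !=set0 >] then inf (K q z) else 1.
have K01 q z a : K q z a -> 0 <= a <= 1.
  by move=> [h _ <-]; rewrite -score_rcons; exact: score01.
have Klb q z : has_lbound (K q z) by exists 0 => a /K01/andP[].
have u01 q z : 0 <= u q z <= 1.
  rewrite /u; case: asboolP => [K0|_]; last by rewrite ler01 lexx.
  apply/andP; split; first by apply: lb_le_inf => // a /K01/andP[].
  have [a Ka] := K0; case/andP: (K01 _ _ _ Ka) => _; apply: le_trans.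
  exact: ge_inf.
have uK q h : u q (m q h) <= legal h (score q) (m q h).
  have Kh : K q (m q h) (legal h (score q) (m q h)) by exists h.
  rewrite /u asboolT; last by eexists; exact: Kh.
  exact: ge_inf.
(* The error allowance left after n rounds; each round spends half of it. *)
pose d n := e / 2 ^+ n.
have d0 n : 0 < d n by rewrite divr_gt0// exprn_gt0.
have dS n : d n = d n.+1 + d n.+1.
  by rewrite /d exprS; field; rewrite expf_neq0.
(* If II could not hold I's gain below this bound, I could play u lowered by a
   small amount, and the answer of m would contradict the definition of u. *)
have /choice[T TP] : forall q, exists T : fdist R Y, consistent m q ->
    forall x, \sum_y T y * u q (x, y) <= score q + d (size q).+2.
  move=> q; have [cq|ncq] := pselect (consistent m q); last first.
    by exists (fdist_dirac point) => /ncq.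
  pose b := d (size q).+3; have b0 : 0 < b by exact: d0.
  pose h z := Num.max 0 (u q z - b).
  have [[s hs]|hT] := minimax_alternative (fun x y => h (x, y)) (score q) point.
    have ah : admissible h (score q).
      split; last by exists s.
      move=> z; rewrite /h le_max lexx /= ge_max ler01 /=.
      by case/andP: (u01 q z) => _ u1; lra.
    have lh : legal h (score q) = h by rewrite /legal asboolT.
    (* At the answer z of [m], [uK] gives [u q z <= h z], which forces [u q z <= 0] and hence a new
       score 0. Scores on consistent histories are nonzero. *)
    exfalso; have := uK q h; rewrite lh {2}/h le_max => /orP[uz|]; last lra.
    apply: (score_neq0 _ (consistent_rcons h cq)); rewrite score_rcons lh.
    by rewrite /h max_l//; lra.
  have [T hTx] := hT _ b0; exists T => _ x.
  apply: (@le_trans _ _ (\sum_y T y * (h (x, y) + b))).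
    apply: ler_sum => y _; rewrite ler_wpM2l ?fdist_ge0//.
    by rewrite -lerBlDr /h le_max lexx orbT.
  by rewrite fdist_expectD dS addrA lerD2r; exact: hTx.
have /choice[hh hhP] : forall qz : hist * Z, exists h, K qz.1 qz.2 !=set0 ->
    m qz.1 h = qz.2 /\
    legal h (score qz.1) qz.2 <= u qz.1 qz.2 + d (size qz.1).+2.
  move=> [q z] /=; have [K0|nK] := pselect (K q z !=set0); last first.
    by exists (fun=> 0) => /nK.
  have [|_ [h mh <-] hu] := @inf_adherent _ (K q z) _ (d0 (size q).+2).
    by split.
  by exists h => _; split=> //; rewrite {1}/u asboolT// ltW.
pose next q z := if `[< K q z !=set0 >] then Some (rcons q (hh (q, z), z))
                 else None.
pose H p := foldl (fun o z => obind (next^~ z) o) (Some [::]) p.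
have HS p z : H (rcons p z) = obind (next^~ z) (H p) by exact: foldl_rcons.
have Hc p q : H p = Some q -> consistent m q.
  elim/last_ind: p q => [|p z ih] q; first by move=> [<-]; exact: consistent_nil.
  rewrite HS; case: (H p) ih => //= q' /(_ _ erefl) cq'.
  rewrite /next; case: asboolP => // /(hhP (q', z))/= [mz _] [<-].
  by rewrite -{2}mz; exact: consistent_rcons.
exists (fun p => if H p is Some q then T q else fdist_dirac point) => s.
(* The default 1 applies once a [z] has occurred with which [m] answers no move; [u] is 1 there
   too. *)
pose g p := if H p is Some q then score q + d (size q) else 1.
apply: (@le_trans _ _ (play_measure s
  (fun p => if H p is Some q then T q else fdist_dirac point)
  [set w | exists k, 1 <= g (mkseq w k)])); last first.
  have -> : v + e = g [::] by rewrite /g /= /score /= /d expr0 divr1.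
  apply: ville_inequality => p.
    rewrite /g; case: (H p) => // q; rewrite addr_ge0 ?(ltW (d0 _))//.
    by case/andP: (score01 q).
  rewrite expect_pair /g; case E : (H p) => [q|]; last first.
    apply: fdist_expect_le => x; apply: fdist_expect_le => y.
    by rewrite HS E.
  apply: fdist_expect_le => x.
  (* With n the size of [q], the allowance [d n] splits into [d n.+2] for the choice of [hh],
     [d n.+2] for the near-optimality of [T], and [d n.+1] kept for later. *)
  apply: (@le_trans _ _ (\sum_y T q y *
      (u q (x, y) + (d (size q).+2 + d (size q).+1)))).
    apply: ler_sum => y _; rewrite ler_wpM2l ?fdist_ge0// HS E /= /next.
    case: asboolP => [K0|nK].
      rewrite score_rcons size_rcons addrA lerD2r.
      by have [_] := hhP (q, (x, y)) K0.
    by rewrite /u asboolF// lerDl addr_ge0// ltW.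
  rewrite fdist_expectD (dS (size q)) {3}(dS (size q).+1).
  by have := TP q (Hc _ _ E) x; lra.
apply: le_measure; rewrite ?inE//.
  exact: (visits_measurable [set p | 1 <= g p]).
(* If [g] stayed below 1 along a play in [S], that play would arise from an auxiliary run in which
   II follows [m] and I wins. *)
move=> w Sw; apply: contrapT => /forallNP nw.
have Hw k : exists q, H (mkseq w k) = Some q.
  by have := nw k; rewrite /g; case: (H _) => [q _|/(_ (lexx _))//]; exists q.
pose x k := (if H (mkseq w k) is Some q then hh (q, w k) else fun=> 0, w k).
have Hx k : H (mkseq w k) = Some (mkseq x k) /\ K (mkseq x k) (w k) !=set0.
  have KP k' : H (mkseq w k') = Some (mkseq x k') ->
      K (mkseq x k') (w k') !=set0.
    move=> Hk; have [q] := Hw k'.+1; rewrite mkseqS HS Hk /= /next.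
    by case: asboolP.
  elim: k => [|k [ih Kk]]; first by split; [|exact: KP].
  suff Hk : H (mkseq w k.+1) = Some (mkseq x k.+1) by split; [|exact: KP].
  by rewrite !mkseqS HS ih /= /next asboolT// /x ih.
apply: (mP x); last by left.
move=> k; have [Hk Kk] := Hx k; rewrite {1 3}/x Hk /=.
by have [] := hhP (mkseq x k, w k) Kk.
Qed.

End martin_game.

(** * Determinacy of the auxiliary game and of the Blackwell game *)

Lemma martin_determinacy (R : realType) (X Y : pointedFinType)
    (D : nat -> set (play X Y)) (v : R) : (forall i, Gdelta (D i)) ->
  let win := martin_win (\bigcup_i D i) v in
  wins win [::] \/ exists m : seq ((X * Y -> R) * (X * Y)) ->
      (X * Y -> R) -> X * Y, forall x,
    (forall k, (x k).2 = m (mkseq x k) (x k).1) -> ~ win x.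
Proof.
move=> GD win.
have /choice[G GP] : forall i, exists G : nat -> set (play X Y),
    (forall n, open (G n)) /\ D i = \bigcap_n G n.
  by move=> i; have [G oG DG] := GD i; exists G.
(* Reaching score 0 is an open condition: it takes index 0, the same for all n, and the [D i] are
   shifted by one. *)
pose U i n : set (nat -> (X * Y -> R) * (X * Y)) :=
  if i is j.+1 then [set x | G j n ((fun k => (x k).2) : play X Y)]
  else [set x | exists k, score v (mkseq x k) = 0].
have oU i n : run_open (U i n).
  case: i => [x [k k0]|i x /= Gx]; first by exists k => y yx; exists k; rewrite yx.
  have [k kG] := open_play ((GP i).1 n) Gx.
  exists k => y /mkseq_eqP yx; apply: kG; apply/mkseq_eqP => j jk /=.
  by rewrite yx.
have winE : win = [set x | exists i, forall n, U i n x].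
  apply/seteqP; split=> x.
    move=> [[i _]|x0]; last by exists 0%N.
    by rewrite (GP i).2 => Gx; exists i.+1 => n; exact: Gx.
  move=> [[|i] Ux]; first by right; exact: Ux 0%N.
  by left; exists i => //; rewrite (GP i).2 => n _; exact: Ux.
by rewrite winE; exact: gdelta_sigma_determinacy.
Qed.

Theorem theorem3p10 (R : realType) (X Y : pointedFinType)
    (D : nat -> set (play X Y)) (S : set (play X Y)) :
  (forall i, Gdelta (D i)) -> S = \bigcup_i D i ->
  determined (\1_S : play X Y -> R).
Proof.
move=> GD SD.
have mS : measurable S.
  by rewrite SD; apply: bigcupT_measurable => i; exact: Gdelta_play_measurable.
have EE (s : strategyI R X Y) (t : strategyII R X Y) :
    expected_payoff s t \1_S = play_measure s t S.
  by rewrite /expected_payoff integral_indic// setIT.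
rewrite /determined; set lo := lower_value _; set up := upper_value _.
have lo_up : (lo <= up)%E.
  apply: ge_ereal_sup => _ [s _ <-]; apply: le_ereal_inf_tmp => _ [t _ <-].
  apply: (@le_trans _ _ (expected_payoff s t \1_S)).
    by apply: ge_ereal_inf; exists (expected_payoff s t \1_S) => //; exists t.
  by apply: le_ereal_sup_tmp; exists (expected_payoff s t \1_S) => //; exists s.
have lo_lb (v : R) (s : strategyI R X Y) :
    (forall t, (v%:E <= play_measure s t S)%E) -> (v%:E <= lo)%E.
  move=> vs; apply: le_ereal_sup_tmp; eexists; first by exists s.
  by apply: le_ereal_inf_tmp => _ [t _ <-]; rewrite EE.
have up_ub (v : R) (t : strategyII R X Y) :
    (forall s, (play_measure s t S <= v%:E)%E) -> (up <= v%:E)%E.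
  move=> vt; apply: ge_ereal_inf; eexists; first by exists t.
  by apply: ge_ereal_sup => _ [s _ <-]; rewrite EE.
have lo0 : (0%:E <= lo)%E.
  by apply: (lo_lb _ (fun=> fdist_dirac point)) => t; exact: measure_ge0.
have up1 : (up <= 1%:E)%E.
  by apply: (up_ub _ (fun=> fdist_dirac point)) => s; exact: probability_le1.
apply/eqP; rewrite eq_le lo_up leNgt; apply/negP => lt_lo_up.
have lof : lo \is a fin_num.
  by rewrite ge0_fin_numE//; apply: lt_le_trans lt_lo_up _; exact: leey.
have upf : up \is a fin_num.
  rewrite ge0_fin_numE; last exact: le_trans lo0 lo_up.
  by apply: le_lt_trans up1 _; exact: ltry.
move: lo0 up1 lt_lo_up lo_lb up_ub; rewrite -(fineK lof) -(fineK upf).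
move: (fine lo) (fine up) => a b; rewrite !lee_fin lte_fin => a0 b1 ab lo_lb up_ub.
(* A start score strictly between the two values. A win of I would raise the lower value to [v]; a
   win of II would bring the upper value down to [v] plus a quarter of the gap, still below [b]. *)
pose v := (a + b) / 2.
have v01 : 0 <= v <= 1 by apply/andP; split; rewrite /v; lra.
have [] := martin_determinacy v GD; rewrite -SD.
  move=> /(martin_lower v01 mS)[s /lo_lb]; rewrite lee_fin /v; lra.
move=> [m mP].
have d0 : 0 < (b - a) / 4 by lra.
have [t /up_ub] := martin_upper v01 mS d0 mP.
by rewrite lee_fin /v; lra.
Qed.
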